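(* Let $P_1$ be the uniform distribution on $[0,\frac12]$, let $P_2$ be the discrete distribution with mass $\frac13$ at each point of $D=\{\frac23,\frac56,1\}$, and let $P=\frac12P_1+\frac12P_2$. Let $\alpha$ be an optimal set of four-means for $P$. Then $\alpha=\{\frac18,\frac38,\frac34,1\}$ or $\alpha=\{\frac18,\frac38,\frac23,\frac{11}{12}\}$, and the quantization error is $V_4(P)=\frac{17}{3456}$.
   Context: For a Borel probability measure $Q$ on $\mathbb R$ with finite second moment and a finite nonempty set $\alpha\subset\mathbb R$, put $V(Q;\alpha)=\int\min_{a\in\alpha}(x-a)^2\,dQ(x)$ and $V_n(Q)=\inf\{V(Q;\alpha):\alpha\subset\mathbb R,\ 1\le\mathrm{card}(\alpha)\le n\}$ (the $n$th quantization error). A set $\alpha$ with $1\le\mathrm{card}(\alpha)\le n$ is an optimal set of $n$-means for $Q$ if $V(Q;\alpha)=V_n(Q)$; ''four-means'' is the case $n=4$. *)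

(* Defs.v *)
From HB Require Import structures.
From mathcomp Require Import all_boot all_order all_algebra finmap ring.
From mathcomp Require Import all_classical all_reals all_analysis.

Set Implicit Arguments.
Unset Strict Implicit.
Unset Printing Implicit Defensive.

Import Order.TTheory GRing.Theory Num.Theory.
Import numFieldNormedType.Exports.

Local Open Scope classical_set_scope.
Local Open Scope ring_scope.
Local Open Scope ereal_scope.

Section quantization.
Context {R : realType}.

(* The default value +oo of the minimum is attained only on the empty set.
   As distortions live in \bar R, no second-moment assumption on Q is needed
   for the definitions to make sense. *)
Definition distortion (Q : probability (measurableTypeR R) R)
    (alpha : {fset R}) : \bar R :=
  \int[Q]_x \big[Order.min/+oo]_(a <- alpha) ((x - a) ^+ 2)%R%:E.

Definition codebooks (n : nat) : set {fset R} :=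
  [set alpha | (1 <= #|` alpha| <= n)%N].

Definition quantization_error (n : nat)
    (Q : probability (measurableTypeR R) R) : \bar R :=
  ereal_inf [set distortion Q alpha | alpha in codebooks n].

Definition optimal_means (n : nat)
    (Q : probability (measurableTypeR R) R) (alpha : {fset R}) : Prop :=
  codebooks n alpha /\ distortion Q alpha = quantization_error n Q.

End quantization.

Section mixed_distribution.
Context (R : realType).

Fact half_gt0 : (0 < 1 / 2 :> R)%R. Proof. by rewrite divr_gt0. Qed.

Definition P1 : probability (measurableTypeR R) R := uniform_prob half_gt0.

Definition P2 : set (measurableTypeR R) -> \bar R :=
  msum (fun k => mscale (1 / 3)%:nng%R
    \d_([:: 2 / 3; 5 / 6; 1]%R`_k : measurableTypeR R)) 3.

HB.instance Definition _ := Measure.on P2.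

Let P2_setT : P2 [set: _] = 1.
Proof.
rewrite /P2 /msum !big_ord_recl big_ord0 /= /mscale /= !diracT !mule1 adde0.
rewrite -!EFinD.
by congr EFin => /=; field.
Qed.

HB.instance Definition _ := Measure_isProbability.Build _ _ _ P2 P2_setT.

Definition P : set (measurableTypeR R) -> \bar R :=
  measure_add (mscale (1 / 2)%:nng%R P1) (mscale (1 / 2)%:nng%R P2).

HB.instance Definition _ := Measure.on P.

Let P_setT : P [set: _] = 1.
Proof.
rewrite /P measure_addE.
set Q1 := (X in X + _ = _); set Q2 := (X in _ + X = _).
have -> : Q1 = (1 / 2)%R%:E * P1 [set: _] by [].
have -> : Q2 = (1 / 2)%R%:E * P2 [set: _] by [].
rewrite probability_setT P2_setT !mule1 -EFinD.
by congr EFin => /=; field.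
Qed.

HB.instance Definition _ := Measure_isProbability.Build _ _ _ P P_setT.

End mixed_distribution.

Arguments P2 : clear implicits.
Arguments P : clear implicits.

(* Main.v *)
(* Order the four means (repeating one if there are fewer); the midpoints cut
   [0, 1/2] into four intervals of total length 1/2, one for each mean. A mean
   which also serves a point of D pays at least L/36 for an interval of length L,
   since D stays at distance 1/6 from [0, 1/2], while an interval of length L
   costs at least L^3/12 in any case.
   - If one mean serves all of D, the cost on D alone is too large.
   - If two means serve D, their intervals having total length M, then D costs
     at least 1/432 and the whole at least
     1/432 + M/36 + (1/2 - M)^3/48 >= 17/3456 + M (1/36 - 1/64).
     Equality forces M = 0, leaves two intervals of length 1/4 served by their
     midpoints, and pairs adjacent points of D.
   - If three means serve D, the cost is at least M/36 + (1/2 - M)^3/12, which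
     is too large for every M. *)

Require Import Defs.
From mathcomp Require Import all_boot all_order all_algebra finmap.
From mathcomp Require Import all_classical all_reals all_analysis.
From mathcomp Require Import measurable_realfun.
From mathcomp Require Import ring lra.

Set Implicit Arguments.
Unset Strict Implicit.
Unset Printing Implicit Defensive.

Import Order.TTheory GRing.Theory Num.Theory.
Import numFieldNormedType.Exports.

Section quantization_cells.
Context (R : realType).
Local Open Scope classical_set_scope.
Local Open Scope ring_scope.
Implicit Types (a b c s t x : R) (l : seq R).

(** * Squared distance to a list of means *)

(** The integrand of [distortion], on lists rather than finite sets: lists can be sorted, padded
    with repetitions and used for induction. *)
Definition sqdist l x : \bar R :=
  \big[Order.min/+oo%E]_(a <- l) ((x - a) ^+ 2)%:E.

Lemma sqdist_le l a x : a \in l -> (sqdist l x <= ((x - a) ^+ 2)%:E)%E.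
Proof. by move=> al; apply: bigmin_inf_seq al _ _. Qed.

Lemma sqdist_attained a l x :
  exists2 b, b \in a :: l & sqdist (a :: l) x = ((x - b) ^+ 2)%:E.
Proof.
elim: l a => [|b l IH] a; rewrite /sqdist big_cons.
  by exists a; rewrite ?mem_head// big_nil minEle leey.
have [c cl] := IH b; rewrite {1}/sqdist => ->.
rewrite minEle; case: ifP => _; first by exists a; rewrite ?mem_head.
by exists c => //; rewrite in_cons cl orbT.
Qed.

Lemma le_sqdist l (y : \bar R) x :
  (forall a, a \in l -> (y <= ((x - a) ^+ 2)%:E)%E) -> (y <= sqdist l x)%E.
Proof.
elim: l => [|a l IH] yl; rewrite /sqdist ?big_nil ?leey// big_cons le_min.
rewrite yl ?mem_head//=; apply: IH => b bl.
by apply: yl; rewrite in_cons bl orbT.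
Qed.

Lemma sqdist_ge0 l x : (0 <= sqdist l x)%E.
Proof. by apply: le_sqdist => a _; rewrite lee_fin sqr_ge0. Qed.

Lemma eq_sqdist l l' x : l =i l' -> sqdist l x = sqdist l' x.
Proof.
by move=> ll'; apply/le_anti/andP; split; apply: le_sqdist => a al;
  apply: sqdist_le; rewrite ?ll'// -ll'.
Qed.

Lemma measurable_sqrB a :
  measurable_fun [set: R] (fun x => ((x - a) ^+ 2)%:E).
Proof.
by apply/measurable_EFinP; apply: measurable_funX; exact: measurable_funB.
Qed.

Lemma measurable_sqdist l : measurable_fun [set: R] (sqdist l).
Proof.
elim: l => [|a l IH].
  rewrite (_ : sqdist [::] = cst +oo%E); first exact: measurable_cst.
  by apply/funext => x; rewrite /sqdist big_nil.
rewrite (_ : sqdist _ = fun x => Order.min ((x - a) ^+ 2)%:E (sqdist l x)).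
  by apply: measurable_mine => //; exact: measurable_sqrB.
by apply/funext => x; rewrite /sqdist big_cons.
Qed.

(** For [c] in the tail, (x - c)^2 - (x - a)^2 = (c - a)(a + c - 2x), and both factors are
    nonnegative because b <= c. *)
Lemma sqdist_cons_left a b l x :
  sorted <=%R [:: a, b & l] -> x <= (a + b) / 2 ->
  sqdist [:: a, b & l] x = ((x - a) ^+ 2)%:E.
Proof.
rewrite /= => /andP[ab bl] xab; apply/le_anti/andP; split.
  by apply: sqdist_le; rewrite mem_head.
have bmin c : c \in b :: l -> b <= c.
  rewrite in_cons => /orP[/eqP->//|cl].
  by have /allP/(_ c cl) := order_path_min le_trans bl.
apply: le_sqdist => c; rewrite in_cons => /orP[/eqP->//|/bmin bc].
by rewrite lee_fin; nra.
Qed.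

Lemma sqdist_cons_right a b l x :
  a <= b -> (a + b) / 2 <= x -> sqdist [:: a, b & l] x = sqdist (b :: l) x.
Proof.
move=> ab abx; rewrite {1}/sqdist big_cons; apply/min_idPr.
apply: (le_trans (@sqdist_le (b :: l) b x (mem_head b l))).
by rewrite lee_fin; nra.
Qed.

(** * Integration over an interval cut at the midpoints *)

Local Notation mu := (@lebesgue_measure R).

(* The integral of (x - a)^2 over [s, t]. *)
Definition cell s t a : R := ((t - a) ^+ 3 - (s - a) ^+ 3) / 3.

Lemma integral_sqr s t a : s <= t ->
  (\int[mu]_(x in `[s, t]) ((x - a) ^+ 2)%:E = (cell s t a)%:E)%E.
Proof.
rewrite le_eqVlt => /predU1P[->|st].
  by rewrite set_itv1 integral_set1 /cell subrr mul0r.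
pose F x : R := (x - a) ^+ 3 / 3.
have dF (y : R) : is_derive y (1 : R) F ((y - a) ^+ 2).
  by apply: is_derive_eq; rewrite /GRing.scale/= !mulr0 !subr0 add0r; field.
have cF (y : R) : F @ y --> F y.
  by apply: differentiable_continuous; apply/derivable1_diffP; case: (dF y).
rewrite (@continuous_FTC2 _ _ F _ _ st).
- by rewrite -EFinB /F /cell -mulrBl.
- apply: continuous_subspaceT => y.
  by apply: differentiable_continuous; apply/derivable1_diffP; exact: ex_derive.
- split.
  + by move=> y _; case: (dF y).
  + exact: cvg_at_right_filter.
  + exact: cvg_at_left_filter.
- by move=> y _; rewrite derive1E; case: (dF y).
Qed.

Lemma integral_itv_split (f : R -> \bar R) s c t :
  measurable_fun [set: R] f -> (forall x, (0 <= f x)%E) ->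
  s <= c -> c <= t ->
  (\int[mu]_(x in `[s, t]) f x =
   \int[mu]_(x in `[s, c]) f x + \int[mu]_(x in `[c, t]) f x)%E.
Proof.
move=> mf f0 sc ct.
rewrite (@itv_bndbnd_setU _ _ (BLeft s) (BRight c) (BRight t)) ?bnd_simp//.
rewrite ge0_integral_setU//=.
- congr +%E; apply: integral_itv_obnd_cbnd.
  exact: measurable_funTS.
- exact: measurable_funTS.
- apply/disj_setPRL => x /=; rewrite !in_itv/= => /andP[cx _] /andP[_ xc].
  by have := lt_le_trans cx xc; rewrite ltxx.
Qed.

Lemma cellxx s a : cell s s a = 0.
Proof. by rewrite /cell subrr mul0r. Qed.

(** Induction on the list, cutting at the midpoint of the first two means. If it falls outside the
    interval, cells degenerate to an endpoint, so each mean keeps exactly one cell, possibly of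
    length 0. *)
Lemma integral_sqdist_cells a l s t : s <= t -> sorted <=%R (a :: l) ->
  exists c : nat -> R, [/\ c 0%N = s, c (size l).+1 = t,
    forall i, c i <= c i.+1 &
    (\int[mu]_(x in `[s, t]) sqdist (a :: l) x =
     (\sum_(i < (size l).+1) cell (c i) (c i.+1) (a :: l)`_i)%:E)%E].
Proof.
elim: l a s => [|b l IH] a s st al.
  exists (fun i => if i is 0%N then s else t); split => // [[]//|].
  rewrite big_ord1/= -integral_sqr//; apply: eq_integral => x _.
  by rewrite /sqdist big_seq1.
have [ab bl] : a <= b /\ sorted <=%R (b :: l) by move: al => /=/andP[].
have [tm|mt] := leP t ((a + b) / 2).
  exists (fun i => if i is 0%N then s else t); split => // [[]//|].
  rewrite big_ord_recl big1 ?addr0 => [|i _]; last exact: cellxx.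
  rewrite -integral_sqr//; apply: eq_integral => x.
  rewrite inE/= in_itv/= => /andP[_ xt].
  by rewrite sqdist_cons_left//; exact: le_trans tm.
have [ms|sm] := leP ((a + b) / 2) s.
  have [c [c0 ct cmono cE]] := IH b s st bl.
  exists (fun i => if i is j.+1 then c j else s); split => // [[|i]//|].
    by rewrite c0.
  rewrite big_ord_recl/= c0 cellxx add0r -cE; apply: eq_integral => x.
  rewrite inE/= in_itv/= => /andP[sx _].
  by rewrite sqdist_cons_right//; exact: le_trans sx.
have [c [c0 ct cmono cE]] := IH b _ (ltW mt) bl.
exists (fun i => if i is j.+1 then c j else s); split => // [[|i]//|].
  by rewrite c0 ltW.
rewrite (@integral_itv_split _ _ ((a + b) / 2)) ?ltW//; last 2 first.
- exact: measurable_sqdist.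
- by move=> x; exact: sqdist_ge0.
rewrite big_ord_recl/= EFinD -cE c0 -integral_sqr ?ltW//; congr +%E.
  apply: eq_integral => x; rewrite inE/= in_itv/= => /andP[_ xm].
  by rewrite sqdist_cons_left.
apply: eq_integral => x; rewrite inE/= in_itv/= => /andP[mx _].
by rewrite sqdist_cons_right.
Qed.

(** * The distortion for [P] *)

Lemma distortionE (alpha : {fset R}) :
  distortion (P R) alpha =
  (\int[mu]_(x in `[0%R, (1 / 2)%R]) sqdist alpha x + (1 / 6)%:E *
    (sqdist alpha (2 / 3)%R + sqdist alpha (5 / 6)%R + sqdist alpha 1%R))%E.
Proof.
have mf := measurable_sqdist alpha.
have f0 x := sqdist_ge0 alpha x.
have fD0 (x : measurableTypeR R) : [set: measurableTypeR R] x ->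
  (0 <= (sqdist alpha : measurableTypeR R -> \bar R) x)%E by move=> _.
transitivity (\int[P R]_x sqdist alpha x)%E; first by [].
rewrite /P ge0_integral_measure_add// !ge0_integral_mscale//.
rewrite /P1 integral_uniform// /P2 ge0_integral_measure_sum//.
rewrite !big_ord_recl big_ord0 /= !ge0_integral_mscale//.
have dirac_int (d : measurableTypeR R) :
    (\int[\d_d]_x sqdist alpha x = sqdist alpha d)%E.
  by rewrite (@integral_dirac _ (measurableTypeR R))// diracT mul1e.
rewrite !dirac_int adde0 muleA -EFinM.
(* The density 2 of [P1] cancels its weight 1/2 in [P]. *)
rewrite (_ : 1 / 2 * (1 / 2 - 0)^-1 = 1)%R; last by field.
rewrite mul1e; congr +%E.
rewrite !ge0_muleDr ?adde_ge0 ?mule_ge0 ?lee_fin//= !muleA -EFinM addeA.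
by rewrite (_ : 1 / 2 * (1 / 3) = 1 / 6)%R; last by field.
Qed.

(** * Lower bounds on the cost of a cell *)

(** Parallel axis identity: the moment about the midpoint, plus the length times the squared offset
    of [a]. *)
Lemma cellE s t a :
  cell s t a = (t - s) ^+ 3 / 12 + (t - s) * (a - (s + t) / 2) ^+ 2.
Proof. by rewrite /cell; field. Qed.

Lemma cell_ge s t a : s <= t -> (t - s) ^+ 3 / 12 <= cell s t a.
Proof. by move=> st; rewrite cellE lerDl mulr_ge0 ?sqr_ge0 ?subr_ge0. Qed.

Lemma cell_ge0 s t a : s <= t -> 0 <= cell s t a.
Proof.
move=> st; apply: le_trans (cell_ge a st).
by rewrite divr_ge0 ?exprn_ge0 ?subr_ge0.
Qed.

(* The minimum over [u + v = x] of [l u^2 + w v^2] is [l w x^2 / (l + w)]. *)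
Lemma weighted_sqr_ge (k l w x u v : R) :
  0 <= l -> 0 < w -> 0 <= x -> x <= u + v -> k * (l + w) <= w * x ^+ 2 ->
  k * l <= l * u ^+ 2 + w * v ^+ 2.
Proof.
move=> l0 w0 x0 xuv kw.
have lw : 0 < l + w by rewrite ltr_wpDl.
rewrite -(ler_pM2r lw).
have x2 : x ^+ 2 <= (u + v) ^+ 2 by rewrite lerXn2r ?nnegrE//; lra.
have -> : (l * u ^+ 2 + w * v ^+ 2) * (l + w) =
  (l * u - w * v) ^+ 2 + l * (w * (u + v) ^+ 2) by ring.
rewrite -(add0r (k * l * (l + w))) lerD ?sqr_ge0//.
rewrite (_ : k * l * (l + w) = l * (k * (l + w))); last by ring.
by rewrite ler_wpM2l// (le_trans kw)// ler_pM2l.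
Qed.

(** The mean is torn between [d] and the midpoint of [s, t], which lie at least 1/6 + (t - s)/2
    apart. The constant 1/36 is sharp as t - s tends to 0. *)
Lemma cell_serve1 s t a d : s <= t -> t <= 1 / 2 -> 2 / 3 <= d ->
  (t - s) / 36 <= cell s t a + (d - a) ^+ 2 / 6.
Proof.
move=> st t2 d23.
have : 1 / 36 * (t - s) <=
    (t - s) * (a - (s + t) / 2) ^+ 2 + 1 / 6 * (d - a) ^+ 2.
  by apply: (@weighted_sqr_ge _ _ _ (1 / 6 + (t - s) / 2)); nra.
have : 0 <= (t - s) ^+ 3 by rewrite exprn_ge0 ?subr_ge0.
rewrite cellE; lra.
Qed.

(** As before, with [d] and [e] replaced by their centroid of weight 1/3, at least 3/4; their spread
    about it contributes (e - d)^2 / 12. *)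
Lemma cell_serve2 s t a d e : s <= t -> t <= 1 / 2 -> 3 / 2 <= d + e ->
  (t - s) / 36 + (e - d) ^+ 2 / 12 <=
  cell s t a + ((d - a) ^+ 2 + (e - a) ^+ 2) / 6.
Proof.
move=> st t2 de.
have : 1 / 36 * (t - s) <=
    (t - s) * (a - (s + t) / 2) ^+ 2 + 1 / 3 * ((d + e) / 2 - a) ^+ 2.
  by apply: (@weighted_sqr_ge _ _ _ (1 / 4 + (t - s) / 2)); nra.
have : 0 <= (t - s) ^+ 3 by rewrite exprn_ge0 ?subr_ge0.
rewrite cellE; lra.
Qed.

(* The tangent at [m = 0] of the convex lower bound [(1/2 - m)^3 / 48]. *)
Lemma two_cubes_ge (x y m : R) :
  0 <= x -> 0 <= y -> 0 <= m -> x + y + m = 1 / 2 ->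
  1 / 384 - m / 64 <= x ^+ 3 / 12 + y ^+ 3 / 12.
Proof.
move=> x0 y0 m0 xym.
have xy : 0 <= (x + y) * (x - y) ^+ 2 by rewrite mulr_ge0 ?addr_ge0 ?sqr_ge0.
have mm : 0 <= m ^+ 2 * (3 / 2 - m) by rewrite mulr_ge0 ?sqr_ge0//; lra.
have -> : x ^+ 3 / 12 + y ^+ 3 / 12 =
  (x + y) ^+ 3 / 48 + (x + y) * (x - y) ^+ 2 / 16 by field.
have -> : x + y = 1 / 2 - m by lra.
have -> : (1 / 2 - m) ^+ 3 = 1 / 8 - 3 / 4 * m + m ^+ 2 * (3 / 2 - m) by field.
have xy' : 0 <= (1 / 2 - m) * (x - y) ^+ 2.
  by rewrite (_ : 1 / 2 - m = x + y)//; lra.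
lra.
Qed.

Lemma sqr_le0_eq0 x : x ^+ 2 <= 0 -> x = 0.
Proof. by move=> x0; apply/eqP; rewrite -sqrf_eq0 eq_le x0 sqr_ge0. Qed.

(* The mean [p] serves [d] and [e], the mean [q] serves [f], and [r] and [u]
   serve no point of D; 7/576 is 1/36 - 1/64. *)
Lemma two_servers_ge s1 t1 p s2 t2 q s3 t3 r s4 t4 u d e f :
  s1 <= t1 -> s2 <= t2 -> s3 <= t3 -> s4 <= t4 ->
  t1 <= 1 / 2 -> t2 <= 1 / 2 ->
  (t1 - s1) + (t2 - s2) + (t3 - s3) + (t4 - s4) = 1 / 2 ->
  3 / 2 <= d + e -> 2 / 3 <= f ->
  1 / 384 + (e - d) ^+ 2 / 12 + ((t1 - s1) + (t2 - s2)) * (7 / 576) <=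
  cell s1 t1 p + cell s2 t2 q + cell s3 t3 r + cell s4 t4 u +
    ((d - p) ^+ 2 + (e - p) ^+ 2 + (f - q) ^+ 2) / 6.
Proof.
move=> st1 st2 st3 st4 t1_le t2_le length1 de f23.
have := cell_serve2 p st1 t1_le de.
have := cell_serve1 q st2 t2_le f23.
have := cell_ge r st3; have := cell_ge u st4.
have : 1 / 384 - ((t1 - s1) + (t2 - s2)) / 64 <=
    (t3 - s3) ^+ 3 / 12 + (t4 - s4) ^+ 3 / 12.
  by apply: two_cubes_ge; lra.
lra.
Qed.

(** Since 1/384 + 1/432 = 17/3456, no excess over the lower bound is left: the serving cells have
    length 0, and then every remaining square vanishes. *)
Lemma two_servers_eq s1 t1 p s2 t2 q s3 t3 r s4 t4 u d e f :
  s1 <= t1 -> s2 <= t2 -> s3 <= t3 -> s4 <= t4 ->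
  t1 <= 1 / 2 -> t2 <= 1 / 2 ->
  (t1 - s1) + (t2 - s2) + (t3 - s3) + (t4 - s4) = 1 / 2 ->
  3 / 2 <= d + e -> 2 / 3 <= f -> 1 / 36 <= (e - d) ^+ 2 ->
  cell s1 t1 p + cell s2 t2 q + cell s3 t3 r + cell s4 t4 u +
    ((d - p) ^+ 2 + (e - p) ^+ 2 + (f - q) ^+ 2) / 6
    <= 17 / 3456 ->
  [/\ p = (d + e) / 2, q = f,
      t3 = s3 + 1 / 4 /\ r = s3 + 1 / 8 & t4 = s4 + 1 / 4 /\ u = s4 + 1 / 8].
Proof.
move=> st1 st2 st3 st4 t1_le t2_le length1 de f23 de_sep total_le.
have total_ge :=
  two_servers_ge p q r u st1 st2 st3 st4 t1_le t2_le length1 de f23.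
have t1E : t1 = s1 by lra.
have t2E : t2 = s2 by lra.
move: total_le; rewrite t1E t2E !cellE.
set x := t3 - s3; set y := t4 - s4.
have x0 : 0 <= x by rewrite subr_ge0.
have y0 : 0 <= y by rewrite subr_ge0.
have xy : x + y = 1 / 2 by rewrite /x /y; lra.
set r2 := (r - _) ^+ 2; set u2 := (u - _) ^+ 2.
have xr : 0 <= x * r2 by rewrite mulr_ge0 ?sqr_ge0.
have yu : 0 <= y * u2 by rewrite mulr_ge0 ?sqr_ge0.
have -> : (d - p) ^+ 2 + (e - p) ^+ 2 =
  2 * (p - (d + e) / 2) ^+ 2 + (e - d) ^+ 2 / 2 by field.
have cubes : x ^+ 3 / 12 + y ^+ 3 / 12 = 1 / 384 + (x - 1 / 4) ^+ 2 / 8.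
  by rewrite (_ : y = 1 / 2 - x); [field | lra].
have := sqr_ge0 (p - (d + e) / 2); have := sqr_ge0 (f - q).
have := sqr_ge0 (x - 1 / 4) => h1 h2 h3 total_le.
have x4 : x - 1 / 4 = 0 by apply: sqr_le0_eq0; lra.
have xE : x = 1 / 4 by lra.
have yE : y = 1 / 4 by lra.
have fq : f - q = 0 by apply: sqr_le0_eq0; lra.
have pde : p - (d + e) / 2 = 0 by apply: sqr_le0_eq0; lra.
(* With [x] and [y] now positive constants, the products with [r2] and [u2] become linear and force
   both squares to vanish. *)
rewrite xE yE in xr yu cubes total_le.
have rE : r - (s3 + t3) / 2 = 0.
  by apply: sqr_le0_eq0; rewrite -/r2; lra.
have uE : u - (s4 + t4) / 2 = 0.
  by apply: sqr_le0_eq0; rewrite -/u2; lra.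
by move: xE yE; rewrite /x /y => xE yE; split; [lra|lra|split; lra|split; lra].
Qed.

(** The best choice is the centroid 5/6, which costs 1/108. *)
Lemma one_server_gt a :
  17 / 3456 < ((2 / 3 - a) ^+ 2 + (5 / 6 - a) ^+ 2 + (1 - a) ^+ 2) / 6.
Proof. by have := sqr_ge0 (a - 5 / 6); lra. Qed.

Lemma three_servers_gt s1 t1 p s2 t2 q s3 t3 r s4 t4 u d e f :
  s1 <= t1 -> s2 <= t2 -> s3 <= t3 -> s4 <= t4 ->
  t1 <= 1 / 2 -> t2 <= 1 / 2 -> t3 <= 1 / 2 ->
  (t1 - s1) + (t2 - s2) + (t3 - s3) + (t4 - s4) = 1 / 2 ->
  2 / 3 <= d -> 2 / 3 <= e -> 2 / 3 <= f ->
  17 / 3456 < cell s1 t1 p + cell s2 t2 q + cell s3 t3 r + cell s4 t4 u +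
    ((d - p) ^+ 2 + (e - q) ^+ 2 + (f - r) ^+ 2) / 6.
Proof.
move=> st1 st2 st3 st4 t1_le t2_le t3_le length1 d23 e23 f23.
have := cell_serve1 p st1 t1_le d23.
have := cell_serve1 q st2 t2_le e23.
have := cell_serve1 r st3 t3_le f23.
have := cell_ge u st4; set y := t4 - s4 => cy.
have y0 : 0 <= y by rewrite subr_ge0.
(* Tangent to the cube at 1/3, where the bound (1/2 - y)/36 + y^3/12 is minimal, with value
   5/648. *)
have tangent : y / 3 - 2 / 27 <= y ^+ 3.
  have : 0 <= (y - 1 / 3) ^+ 2 * (y + 2 / 3) by rewrite mulr_ge0 ?sqr_ge0//; lra.
  lra.
move: length1; rewrite -/y; lra.
Qed.

(** * Completing distinct indices to all four *)

Lemma exists_notin_ord4 (z : seq 'I_4) : (size z < 4)%N -> exists i, i \notin z.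
Proof.
move=> z4; have [i iz|zT] := pickP [pred i | i \notin z]; first by exists i.
have : {subset enum 'I_4 <= z} by move=> i _; have /negbFE := zT i.
by move=> /(uniq_leq_size (enum_uniq _)); rewrite size_enum_ord leqNgt z4.
Qed.

Lemma perm_ord4 (z : seq 'I_4) : uniq z -> size z = 4%N -> perm_eq z (enum 'I_4).
Proof.
move=> zu z4; apply: uniq_perm => //; first exact: enum_uniq.
apply: (uniq_min_size zu _ _).2 => [i _|]; first by rewrite mem_enum.
by rewrite z4 size_enum_ord.
Qed.

Lemma complete_ord4_1 (i j k : 'I_4) : uniq [:: i; j; k] ->
  exists l : 'I_4, uniq [:: i; j; k; l].
Proof.
move=> ijk; have [l lP] := @exists_notin_ord4 [:: i; j; k] isT.
by exists l; rewrite -[[:: _; _; _; _]]/(rcons [:: i; j; k] l) rcons_uniq lP.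
Qed.

Lemma complete_ord4_2 (i j : 'I_4) : i != j ->
  exists k l : 'I_4, uniq [:: i; j; k; l].
Proof.
move=> ij; have [k kP] := @exists_notin_ord4 [:: i; j] isT.
exists k; apply: complete_ord4_1.
by rewrite -[[:: _; _; _]]/(rcons [:: i; j] k) rcons_uniq kP /= inE ij.
Qed.

(** * Four cells with prescribed servers of D *)

Section four_cells.
Variables (c : nat -> R) (b : seq R).
Hypotheses (b4 : size b = 4%N) (c0 : c 0%N = 0) (c4 : c 4%N = 1 / 2).
Hypothesis c_nondecr : forall n, c n <= c n.+1.

Let cost (n : nat) := cell (c n) (c n.+1) b`_n.

Let c_homo : {homo c : m n / (m <= n)%N >-> m <= n}.
Proof. by apply/nondecreasing_seqP. Qed.

Let c_le (n : 'I_4) : c n.+1 <= 1 / 2.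
Proof. by rewrite -c4; apply: c_homo. Qed.

Let c_ge (n : 'I_4) : 0 <= c n.
Proof. by rewrite -c0; apply: c_homo. Qed.

Let sum_ord4 (F : nat -> R) (i j k l : 'I_4) : uniq [:: i; j; k; l] ->
  \sum_(n < 4) F n = F i + F j + F k + F l.
Proof.
move=> /perm_ord4 /(_ erefl) ijkl.
rewrite -(big_enum _ _ _ _)/= -(perm_big _ ijkl)/=.
by rewrite !big_cons big_nil addr0 !addrA.
Qed.

Let lengths (i j k l : 'I_4) : uniq [:: i; j; k; l] ->
  (c i.+1 - c i) + (c j.+1 - c j) + (c k.+1 - c k) + (c l.+1 - c l) = 1 / 2.
Proof.
move=> ijkl; rewrite -(sum_ord4 (fun n => c n.+1 - c n) ijkl).
rewrite -(big_mkord xpredT (fun n => c n.+1 - c n)).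
by rewrite telescope_sumr// c0 c4 subr0.
Qed.

Let mem_b (i j k l : 'I_4) : uniq [:: i; j; k; l] ->
  b =i [:: b`_i; b`_j; b`_k; b`_l].
Proof.
move=> /perm_ord4 /(_ erefl) ijkl x.
have := perm_mem (perm_map (fun n : 'I_4 => b`_n) ijkl) x; rewrite /= => ->.
by rewrite -[in LHS](mkseq_nth 0 b) b4 /mkseq -val_enum_ord -map_comp.
Qed.

(* The indices [i], [j], [k] are those of the means serving 2/3, 5/6 and 1. *)
Definition total_cost (i j k : nat) := \sum_(n < 4) cost n +
  ((2 / 3 - b`_i) ^+ 2 + (5 / 6 - b`_j) ^+ 2 + (1 - b`_k) ^+ 2) / 6.

(** For adjacent [d] and [e] in D the left side is 17/3456; for the pair 2/3, 1 it is strictly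
    larger. *)
Let pair_ge (i k : 'I_4) (d e f : R) : i != k ->
  3 / 2 <= d + e -> 2 / 3 <= f ->
  1 / 384 + (e - d) ^+ 2 / 12 <= \sum_(n < 4) cost n +
    ((d - b`_i) ^+ 2 + (e - b`_i) ^+ 2 + (f - b`_k) ^+ 2) / 6.
Proof.
move=> ik de f23; have [r [u ikru]] := complete_ord4_2 ik.
rewrite (sum_ord4 cost ikru).
have := two_servers_ge b`_i b`_k b`_r b`_u (c_nondecr i) (c_nondecr k)
  (c_nondecr r) (c_nondecr u) (c_le i) (c_le k) (lengths ikru) de f23.
have := c_nondecr i; have := c_nondecr k; rewrite /cost; lra.
Qed.

Let pair_eq (i k : 'I_4) (d e f : R) : i != k ->
  3 / 2 <= d + e -> 2 / 3 <= f -> 1 / 36 <= (e - d) ^+ 2 ->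
  \sum_(n < 4) cost n +
    ((d - b`_i) ^+ 2 + (e - b`_i) ^+ 2 + (f - b`_k) ^+ 2) / 6 <= 17 / 3456 ->
  b =i [:: (d + e) / 2; f; 1 / 8; 3 / 8].
Proof.
move=> ik de f23 de_sep; have [r [u ikru]] := complete_ord4_2 ik.
rewrite (sum_ord4 cost ikru) => total_le.
have [bi bk [cr br] [cu bu]] := two_servers_eq (c_nondecr i) (c_nondecr k)
  (c_nondecr r) (c_nondecr u) (c_le i) (c_le k) (lengths ikru) de f23 de_sep
  total_le.
move=> x; rewrite (mem_b ikru) bi bk br bu.
have r0 := c_ge r; have u0 := c_ge u; have r1 := c_le r; have u1 := c_le u.
(* Two cells of length 1/4 fill [0, 1/2]; the order of their indices tells which one starts at 0. *)
have [ru|ur|/val_inj ru] := ltngtP r u.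
- have cru := c_homo ru; have -> : c r = 0 by lra.
  have -> : c u = 1 / 4 by lra.
  by rewrite add0r (_ : 1 / 4 + 1 / 8 = 3 / 8); last by lra.
- have cur := c_homo ur; have -> : c u = 0 by lra.
  have -> : c r = 1 / 4 by lra.
  rewrite add0r (_ : 1 / 4 + 1 / 8 = 3 / 8); last by lra.
  by rewrite !inE (orbC (x == 3 / 8)).
- by move: ikru; rewrite ru /= !inE eqxx !(orbT, andbF).
Qed.

(** Cases on which of the three servers coincide; equality is possible only when exactly two
    adjacent points of D share a server. *)
Lemma total_cost_cases (i j k : 'I_4) :
  17 / 3456 <= total_cost i j k /\
  (total_cost i j k <= 17 / 3456 ->
   b =i [:: 1 / 8; 3 / 8; 3 / 4; 1] \/ b =i [:: 1 / 8; 3 / 8; 2 / 3; 11 / 12]).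
Proof.
have cost_ge0 : 0 <= \sum_(n < 4) cost n.
  by apply: sumr_ge0 => n _; apply: cell_ge0; exact: c_nondecr.
suff : 17 / 3456 < total_cost i j k \/ 17 / 3456 <= total_cost i j k /\
    (total_cost i j k <= 17 / 3456 ->
     b =i [:: 3 / 4; 1; 1 / 8; 3 / 8] \/ b =i [:: 11 / 12; 2 / 3; 1 / 8; 3 / 8]).
  case=> [gt|[ge eqb]].
    by split=> [|le]; [exact: ltW | move: (le_lt_trans le gt); rewrite ltxx].
  split=> // /eqb[] bE; [left|right] => x; rewrite bE !inE.
    by do 4 case: eqP => //=.
  by do 4 case: eqP => //=.
rewrite /total_cost; have [<-|ij] := eqVneq i j.
  have [<-|ik] := eqVneq i k.
    by left; have := one_server_gt b`_i; lra.
  right; split=> [|le].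
    by have := @pair_ge i k (2 / 3) (5 / 6) 1 ik; lra.
  left => x; rewrite (pair_eq ik _ _ _ le); [|lra|lra|lra].
  by rewrite (_ : (2 / 3 + 5 / 6) / 2 = 3 / 4)//; lra.
have [<-|jk] := eqVneq j k.
  have ji : j != i by rewrite eq_sym.
  right; split=> [|le].
    by have := @pair_ge j i (5 / 6) 1 (2 / 3) ji; lra.
  right => x; rewrite (@pair_eq j i (5 / 6) 1 (2 / 3) ji); [|lra|lra|lra|lra].
  by rewrite (_ : (5 / 6 + 1) / 2 = 11 / 12)//; lra.
(* The order of [i], [j], [k] is not assumed, so 2/3 and 1 might share a mean while 5/6 has another;
   the gap 1/3 makes this too costly. *)
left; have [<-|ik] := eqVneq i k.
  by have := @pair_ge i j (2 / 3) 1 (5 / 6) ij; lra.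
have [l ijkl] : exists l : 'I_4, uniq [:: i; j; k; l].
  by apply: complete_ord4_1; rewrite /= !inE negb_or ij ik jk.
rewrite (sum_ord4 cost ijkl).
apply: three_servers_gt; rewrite ?c_le ?c_nondecr ?(lengths ijkl)//; lra.
Qed.

End four_cells.

(** * Optimal codebooks *)

(* A codebook with fewer than four points is padded by repeating its last one. *)
Lemma sorted4_of_codebook (alpha : {fset R}) : codebooks 4 alpha ->
  exists b : seq R, [/\ size b = 4%N, sorted <=%R b & b =i alpha].
Proof.
rewrite /codebooks/= => /andP[alpha_gt0 alpha_le4].
have := sort_le_sorted alpha; have := mem_sort <=%R alpha.
have := size_sort <=%R alpha.
move: (sort _ _) => l sl lE sl'.
suff [b [b4 bs bl]] :
    exists b : seq R, [/\ size b = 4%N, sorted <=%R b & b =i l].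
  by exists b; split=> // x; rewrite bl lE.
move: alpha_gt0 alpha_le4; rewrite -sl.
case: l sl' {sl lE} => [|x[|y[|z[|w[]]]]]//=.
- exists [:: x; x; x; x].
  by split=> //=; [rewrite lexx|move=> t; rewrite !inE !orbb].
- move=> /andP[xy _]; exists [:: x; y; y; y].
  by split=> //=; [rewrite lexx xy|move=> t; rewrite !inE !orbb].
- move=> /and3P[xy yz _]; exists [:: x; y; z; z].
  by split=> //=; [rewrite lexx xy yz|move=> t; rewrite !inE !orbb].
- by move=> ls; exists [:: x; y; z; w].
Qed.

(** The value [v] is the [total_cost] of the padded sorted list, with a nearest mean chosen for each
    point of D. *)
Lemma distortion_codebook4 (alpha : {fset R}) : codebooks 4 alpha ->
  exists v : R, [/\ distortion (P R) alpha = v%:E, 17 / 3456 <= v &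
    v <= 17 / 3456 -> alpha =i [:: 1 / 8; 3 / 8; 3 / 4; 1] \/
                      alpha =i [:: 1 / 8; 3 / 8; 2 / 3; 11 / 12]].
Proof.
move=> /sorted4_of_codebook[b [b4 bs bE]].
case: b b4 bs bE => [//|a l] l3 bs bE.
have half_ge0 : 0 <= 1 / 2 :> R by lra.
have [c [c0 c4 cmono cE]] := integral_sqdist_cells half_ge0 bs.
move: (l3) => /= {l3}[l3]; rewrite l3 in c4 cE.
have attained x : exists i : 'I_4,
    sqdist alpha x = ((x - (a :: l)`_i) ^+ 2)%:E.
  have [d dl xd] := sqdist_attained a l x.
  rewrite -(eq_sqdist x bE) xd.
  have d4 : (index d (a :: l) < 4)%N by rewrite -[4%N]/(3%N.+1) -l3 index_mem.
  by exists (Ordinal d4); rewrite nth_index.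
have [i iE] := attained (2 / 3); have [j jE] := attained (5 / 6).
have [k kE] := attained 1.
have l4 : size (a :: l) = 4%N by rewrite /= l3.
have [ge eqb] := total_cost_cases l4 c0 c4 cmono i j k.
exists (total_cost c (a :: l) i j k); split=> //; last first.
  by move=> /eqb[] lE; [left|right] => x; rewrite -bE lE.
rewrite distortionE iE jE kE.
rewrite (_ : sqdist alpha = sqdist (a :: l)).
  by rewrite cE -!EFinD /total_cost mul1r mulrC.
by apply/funext => x; rewrite (eq_sqdist x bE).
Qed.

(** For an upper bound any assignment of means will do: 1/8 and 3/8 take the halves of [0, 1/2], 3/4
    takes 2/3 and 5/6, and 1 takes itself. *)
Lemma distortion_optimum_le :
  (distortion (P R) [fset (1 / 8)%R; (3 / 8)%R; (3 / 4)%R; 1%R]%fset <=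
   (17 / 3456)%:E)%E.
Proof.
set alpha := [fset _; _; _; _]%fset.
have [a18 a38 a34 a1] : [/\ 1 / 8 \in alpha, 3 / 8 \in alpha, 3 / 4 \in alpha &
    1 \in alpha] by rewrite !inE !eqxx !orbT.
rewrite distortionE (@integral_itv_split _ _ (1 / 4)); [|
  exact: measurable_sqdist| by move=> x; exact: sqdist_ge0 | lra | lra].
have le_cell s t a : s <= t -> a \in alpha ->
    (\int[mu]_(x in `[s, t]) sqdist alpha x <= (cell s t a)%:E)%E.
  move=> st aalpha; rewrite -integral_sqr//; apply: ge0_le_integral => //=.
  - by move=> x _; exact: sqdist_ge0.
  - by apply: measurable_funTS; exact: measurable_sqdist.
  - by apply: measurable_funTS; exact: measurable_sqrB.
  - by move=> x _; exact: sqdist_le.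
apply: (@le_trans _ _
  ((cell 0 (1 / 4) (1 / 8))%:E + (cell (1 / 4) (1 / 2) (3 / 8))%:E +
  (1 / 6)%:E * (((2 / 3 - 3 / 4) ^+ 2)%:E + ((5 / 6 - 3 / 4) ^+ 2)%:E +
  ((1 - 1) ^+ 2)%:E))%E).
  apply: leeD; first by apply: leeD; apply: le_cell => //; lra.
  apply: lee_wpmul2l; first by rewrite lee_fin divr_ge0.
  by do 2?apply: leeD; apply: sqdist_le.
by rewrite -!EFinD lee_fin /cell; lra.
Qed.

Lemma quantization_error4 : quantization_error 4 (P R) = (17 / 3456)%:E.
Proof.
apply/le_anti/andP; split.
  apply: le_trans distortion_optimum_le; apply: ereal_inf_lbound => /=.
  exists [fset 1 / 8; 3 / 8; 3 / 4; 1]%fset => //.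
  rewrite /codebooks/= cardfs_gt0; apply/andP; split.
    by apply/fset0Pn; exists 1; rewrite !inE eqxx !orbT.
  (* Counting at most one more element per added point avoids proving the four points distinct. *)
  have addpt (A : {fset R}) x n :
      (#|` A| <= n -> #|` A `|` [fset x]| <= n.+1)%N%fset.
    by move=> An; rewrite cardfsU cardfs1 (leq_trans (leq_subr _ _))// addn1.
  by rewrite !addpt// cardfs1.
apply: le_ereal_inf_tmp => _ [alpha /distortion_codebook4[v [-> v_ge _]] <-].
by rewrite lee_fin.
Qed.

End quantization_cells.

Theorem lemma2p6p3 (R : realType) :
  (forall alpha : {fset R}, optimal_means 4 (P R) alpha ->
     alpha = [fset (1 / 8)%R; (3 / 8)%R; (3 / 4)%R; 1%R]%fset \/
     alpha = [fset (1 / 8)%R; (3 / 8)%R; (2 / 3)%R; (11 / 12)%R]%fset) /\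
  quantization_error 4 (P R) = ((17 / 3456)%R)%:E.
Proof.
split; last exact: quantization_error4.
move=> alpha [/distortion_codebook4[v [-> _ eqv]]].
rewrite quantization_error4 => -[vE].
have [|alphaE|alphaE] := eqv; first by rewrite vE.
- by left; apply/fsetP => x; rewrite alphaE !inE !orbA.
- by right; apply/fsetP => x; rewrite alphaE !inE !orbA.
Qed.
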